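(* Let $R$ be an integral domain. Then the ring $\mathrm{Int}(R)$ is a finite factorization domain (FFD) if and only if $R$ is an FFD.
   Context: For an integral domain $R$ with quotient field $K$, $\mathrm{Int}(R) := \{p(x) \in K[x] \mid p(R) \subseteq R\}$ is the ring of integer-valued polynomials of $R$. An integral domain is atomic if every nonzero nonunit is a finite product of irreducibles. An integral domain is a finite factorization domain (FFD) if it is atomic and every nonzero nonunit has only finitely many factorizations into irreducibles, up to order and associates; equivalently, it is atomic and every nonzero element has only finitely many irreducible divisors up to associates. *)

(* Defs.v *)
From HB Require Import structures.
From mathcomp Require Import all_boot all_order all_algebra.
From mathcomp Require Import boolp.

Set Implicit Arguments.
Unset Strict Implicit.
Unset Printing Implicit Defensive.

Import GRing.Theory.
Local Open Scope ring_scope.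

Section Factorization.
Variable D : idomainType.
Implicit Types (x y : D) (s t : seq D).

Definition irreducible x : Prop :=
  [/\ x != 0, x \isn't a GRing.unit &
    forall a b, x = a * b -> a \is a GRing.unit \/ b \is a GRing.unit].

Definition associated x y : Prop :=
  exists2 u, u \is a GRing.unit & y = u * x.

Definition factorization x s : Prop :=
  {in s, forall a, irreducible a} /\ x = \prod_(a <- s) a.

Definition same_factorization s t : Prop :=
  exists2 s', perm_eq s s' & size s' = size t /\
    forall i, (i < size t)%N -> associated s'`_i t`_i.

Definition atomic : Prop :=
  forall x, x != 0 -> x \isn't a GRing.unit -> exists s, factorization x s.

(* Finiteness of the set of classes of factorizations modulo
   [same_factorization] is expressed by a finite list meeting every class. *)
Definition FFD : Prop :=
  atomic /\
  forall x, x != 0 -> x \isn't a GRing.unit ->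
    exists L : seq (seq D), forall s, factorization x s ->
      exists2 t, t \in L & same_factorization s t.

End Factorization.

Arguments atomic D : clear implicits.
Arguments FFD D : clear implicits.

Section IntegerValued.
Variable R : idomainType.
Local Notation K := {fraction R}.
Local Notation "x %:F" := (@FracField.tofrac R x).
Implicit Types p q : {poly K}.

Definition int_valued : {pred {poly K}} :=
  fun p => `[< forall a : R, exists b : R, p.[a%:F] = b%:F >].

Lemma int_valuedP p :
  reflect (forall a : R, exists b : R, p.[a%:F] = b%:F) (p \in int_valued).
Proof. exact: asboolP. Qed.

Fact int_valued_subring : subring_closed int_valued.
Proof.
split=> [|p q /int_valuedP pP /int_valuedP qP|p q /int_valuedP pP /int_valuedP qP];
  apply/int_valuedP => a.
- by exists 1; rewrite hornerC rmorph1.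
- have [b pb] := pP a; have [c qc] := qP a.
  by exists (b - c); rewrite hornerD hornerN pb qc rmorphB.
- have [b pb] := pP a; have [c qc] := qP a.
  by exists (b * c); rewrite hornerM pb qc rmorphM.
Qed.

HB.instance Definition _ :=
  GRing.isSubringClosed.Build {poly K} int_valued int_valued_subring.

Record int_poly : predArgType :=
  IntPoly { int_poly_val :> {poly K}; _ : int_poly_val \in int_valued }.

HB.instance Definition _ := [isSub for int_poly_val].
HB.instance Definition _ := [Choice of int_poly by <:].
HB.instance Definition _ := [SubChoice_isSubComNzRing of int_poly by <:].

(* These are the units of the ring [int_poly], not those of {poly K}. *)
Definition int_poly_unit : pred int_poly :=
  fun p : int_poly => `[< exists q : int_poly, q * p = 1 >].

Definition int_poly_inv (p : int_poly) : int_poly :=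
  if pselect (exists q : int_poly, q * p = 1) is left ex_q
  then projT1 (cid ex_q) else p.

Fact int_poly_mulVp : {in int_poly_unit, left_inverse 1 int_poly_inv *%R}.
Proof.
move=> p /asboolP p_unit; rewrite /int_poly_inv.
by case: pselect => // ex_q; case: cid.
Qed.

Fact int_poly_unitP (p q : int_poly) : q * p = 1 -> int_poly_unit p.
Proof. by move=> qp1; apply/asboolP; exists q. Qed.

Fact int_poly_inv_out : {in [predC int_poly_unit], int_poly_inv =1 id}.
Proof.
move=> p /asboolP p_nunit; rewrite /int_poly_inv.
by case: pselect.
Qed.

HB.instance Definition _ := GRing.ComNzRing_hasMulInverse.Build int_poly
  int_poly_mulVp int_poly_unitP int_poly_inv_out.

Fact int_poly_mulf_eq0 (p q : int_poly) : p * q = 0 -> (p == 0) || (q == 0).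
Proof.
move=> /(congr1 val)/eqP; rewrite rmorphM rmorph0 mulf_eq0.
by rewrite -!(inj_eq val_inj) rmorph0.
Qed.

HB.instance Definition _ :=
  GRing.ComUnitRing_isIntegral.Build int_poly int_poly_mulf_eq0.

End IntegerValued.

Notation "''Int' ( R )" := (int_poly R)
  (at level 8, format "''Int' ( R )") : type_scope.

(* Main.v *)
Require Import Defs.
From HB Require Import structures.
From mathcomp Require Import all_boot all_order all_algebra.
From mathcomp Require Import boolp generic_quotient.

(** A domain is an FFD exactly when every nonzero element has, up to
    associates, finitely many divisors ([FFD_divisorsP]). This form never
    mentions irreducibles, which behave differently in [R] and in [Int(R)],
    and both implications are proved for it.

    From [Int(R)] to [R]: [R] is a retract of [Int(R)], through the constants
    and the evaluation at 0, and a finite list of representatives of the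
    divisors of a constant is mapped by the retraction to such a list in [R]
    ([finitely_many_divisors_retract]).

    From [R] to [Int(R)]: let [K] be the fraction field of [R] and [g] a
    divisor of a nonzero [f] in [Int(R)]. Over [K], [g] is determined up to a
    nonzero scalar by one of finitely many divisors of [f], since [K[x]] has
    unique factorization ([finitely_many_poly_divisors]). The scalar is
    controlled by one value: if [f(a)] is not 0, then [g(a)] divides [f(a)], so
    it takes finitely many values up to units of [R]; two divisors that agree
    over [K] up to a scalar, and at [a] up to a unit of [R], differ by that
    unit. If no such [a] exists, [R] consists of roots of [f], hence is finite,
    hence is a field; then every nonzero scalar of [K] is a unit of [R]
    ([vanishing_unit]). Both cases are an injection up to associates into a
    finite set of keys ([finitely_many_divisors_by_keys]). *)

Set Implicit Arguments.
Unset Strict Implicit.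
Unset Printing Implicit Defensive.

Import GRing.Theory.
Local Open Scope ring_scope.

(** * Finite factorization in terms of divisors *)

Section Associates.
Variable D : idomainType.
Implicit Types (x y a b c d u : D) (s t : seq D).

Lemma associated_refl x : associated x x.
Proof. by exists 1; rewrite ?unitr1 ?mul1r. Qed.

Lemma associated_sym x y : associated x y -> associated y x.
Proof.
by case=> u uU ->; exists u^-1; rewrite ?unitrV // mulKr.
Qed.

Lemma associated_trans y x z :
  associated x y -> associated y z -> associated x z.
Proof.
by case=> u uU -> [v vU ->]; exists (v * u); rewrite ?unitrM ?vU ?uU ?mulrA.
Qed.

Lemma associatedM x y x' y' :
  associated x y -> associated x' y' -> associated (x * x') (y * y').
Proof.
case=> u uU -> [v vU ->]; exists (u * v); first by rewrite unitrM uU.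
by rewrite mulrACA.
Qed.

Lemma associated_unit u : u \is a GRing.unit -> associated 1 u.
Proof. by exists u; rewrite ?mulr1. Qed.

Definition covers_divisors s x : Prop :=
  forall a b, x = a * b -> exists2 d, d \in s & associated d a.

Definition finitely_many_divisors x : Prop := exists s, covers_divisors s x.

(** Passing to a proper divisor [y] of [a * y] frees the class of [a * y]
    itself, as an associate of [a * y] cannot divide [y]. The strict decrease of
    the list makes it a measure for induction along proper divisors. *)
Lemma covers_proper_divisor s a y :
  a * y != 0 -> a \isn't a GRing.unit -> covers_divisors s (a * y) ->
  exists2 s', (size s' < size s)%N & covers_divisors s' y.
Proof.
move=> ay0 aU s_cov; pose P d := `[< associated d (a * y) >].
exists [seq d <- s | ~~ P d].
  have [d ds dP] := s_cov (a * y) 1 (esym (mulr1 _)).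
  rewrite size_filter -(count_predC P s) -[ltnLHS]add0n ltn_add2r -has_count.
  by apply/hasP; exists d => //; apply/asboolP.
move=> c e def_y; have [|d ds dc] := s_cov c (a * e).
  by rewrite def_y mulrCA.
exists d => //; rewrite mem_filter ds andbT; apply: contra aU => /asboolP dP.
have [v vU acev] := associated_trans (associated_sym dc) dP.
suff aev : a * e = v by move: vU; rewrite -aev unitrM => /andP[].
have c0 : c != 0 by move: ay0; rewrite def_y !mulf_eq0 !negb_or => /and3P[].
by apply: (mulfI c0); rewrite [RHS]mulrC -acev def_y mulrCA.
Qed.

(** Repeatedly splitting off a nonunit factor stops because each proper factor
    has a shorter covering list. *)
Lemma covers_factorization s x :
  x != 0 -> x \isn't a GRing.unit -> covers_divisors s x ->
  exists t, factorization x t.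
Proof.
have [n] := ubnP (size s); elim: n => // n IHn in s x *.
rewrite ltnS => le_s x0 xU s_cov.
have [irr_x|nirr_x] := pselect (irreducible x).
  by exists [:: x]; split=> [a|]; rewrite ?big_seq1 // inE => /eqP ->.
have [a [b [def_x aU bU]]] : exists a b,
    [/\ x = a * b, a \isn't a GRing.unit & b \isn't a GRing.unit].
  apply: contrapT => noab; apply: nirr_x; split=> // a b def_x.
  case aU: (a \is a GRing.unit); first by left.
  case bU: (b \is a GRing.unit); first by right.
  by case: noab; exists a, b; rewrite aU bU.
have [a0 b0] : a != 0 /\ b != 0.
  by apply/andP; move: x0; rewrite def_x mulf_eq0 negb_or.
have proper c y : x = c * y -> y != 0 -> c \isn't a GRing.unit ->
    y \isn't a GRing.unit -> exists t, factorization y t.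
  move=> def_x' y0 cU yU; rewrite def_x' in x0 s_cov.
  have [s' lt_s' s'_cov] := covers_proper_divisor x0 cU s_cov.
  exact: IHn (leq_trans lt_s' le_s) y0 yU s'_cov.
have [ta [ta_irr def_a]] := proper b a (etrans def_x (mulrC _ _)) a0 bU aU.
have [tb [tb_irr def_b]] := proper a b def_x b0 aU bU.
exists (ta ++ tb); split; last by rewrite big_cat /= -def_a -def_b.
by move=> c; rewrite mem_cat => /orP[/ta_irr|/tb_irr].
Qed.

(** The suffix products of a factorization form a chain of proper divisors, and
    each step costs one element of the covering list. *)
Lemma covers_size_factorization s x t :
  x != 0 -> covers_divisors s x -> factorization x t -> (size t <= size s)%N.
Proof.
elim: t s x => // a t IHt s x x0 s_cov [t_irr def_x].
rewrite big_cons in def_x; rewrite def_x in x0 s_cov.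
have [_ aU _] := t_irr a (mem_head _ _).
have [s' lt_s' s'_cov] := covers_proper_divisor x0 aU s_cov.
apply: leq_ltn_trans lt_s'; apply: IHt s'_cov _.
  by move: x0; rewrite mulf_eq0 negb_or => /andP[].
by split=> // b bt; apply: t_irr; rewrite inE bt orbT.
Qed.

(** Shorter words are kept as well, since factorizations of one element may have
    different lengths, and only a bound [n] on these is known. *)
Fixpoint words n s : seq (seq D) :=
  if n is n'.+1 then [::] :: [seq d :: w | d <- s, w <- words n' s]
  else [:: [::]].

Lemma associated_word n s t :
  (size t <= n)%N -> {in t, forall a, exists2 d, d \in s & associated d a} ->
  exists2 w, w \in words n s & same_factorization t w.
Proof.
move=> le_t t_s; suff [w ws [sz_w tw]] : exists2 w, w \in words n s &
    size t = size w /\ forall i, (i < size t)%N -> associated t`_i w`_i.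
  by exists w => //; exists t; rewrite ?perm_refl -?sz_w.
elim: t n le_t t_s => [|a t IHt] [|n] //= le_t t_s.
- by exists [::]; rewrite ?inE.
- by exists [::]; rewrite ?inE.
have [d ds da] := t_s a (mem_head _ _).
have [b bt|w ws [sz_w tw]] := IHt n le_t; first by apply: t_s; rewrite inE bt orbT.
exists (d :: w); last first.
  rewrite /= sz_w; split=> // [[|i]] /= lt_i; first exact: associated_sym.
  by apply: tw; rewrite sz_w.
by rewrite inE; apply/orP; right; apply/allpairsP; exists (d, w).
Qed.

Fixpoint subproducts s : seq D :=
  if s is a :: s' then subproducts s' ++ [seq a * d | d <- subproducts s']
  else [:: 1].

(** Each divisor [a] of [x = a * b] arises as a partial product of a
    factorization of [x], by concatenating factorizations of [a] and [b]; so the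
    finitely many subproducts of finitely many representatives are enough. *)
Lemma subproductsP s1 s2 t : same_factorization (s1 ++ s2) t ->
  exists2 d, d \in subproducts t & associated d (\prod_(a <- s1) a).
Proof.
case=> s s12 [sz_s st]; move: sz_s st s12.
elim: t s s1 s2 => [|c t IHt] [|b s] // s1 s2.
  move=> _ _ s12; have := perm_nilP s12; case: s1 {s12} => // _.
  by exists 1; rewrite ?inE // big_nil; apply: associated_refl.
move=> [sz_s] st s12.
have bc : associated c b by apply/associated_sym/(st 0%N).
have {}st i : (i < size t)%N -> associated s`_i t`_i by move=> lt_i; apply: (st i.+1).
have : b \in s1 ++ s2 by rewrite (perm_mem s12) mem_head.
rewrite mem_cat => /orP[b1|b2].
- have s1E := perm_to_rem b1.
  have [|d dt dE] := IHt s (rem b s1) s2 sz_s st.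
    rewrite -(perm_cons b); apply: perm_trans s12.
    by rewrite -cat_cons perm_cat2r perm_sym.
  exists (c * d); first by rewrite mem_cat map_f ?orbT.
  by rewrite (perm_big _ s1E) big_cons; apply: associatedM.
- have s2E := perm_to_rem b2.
  have [|d dt dE] := IHt s s1 (rem b s2) sz_s st; last first.
    by exists d; rewrite ?mem_cat ?dt.
  rewrite -(perm_cons b); apply: perm_trans s12.
  by rewrite -cat1s perm_catCA perm_cat2l /= perm_sym.
Qed.

(** Forwards, the divisors are the units, the associates of [x], and subproducts
    of factorizations. Backwards, a covering list [s] bounds the length of
    factorizations by [size s], and their entries are divisors too. *)
Lemma FFD_divisorsP : FFD D <-> forall x, x != 0 -> finitely_many_divisors x.
Proof.
split=> [[atomD finD] x x0 | finD].
  case xU: (x \is a GRing.unit).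
    exists [:: 1] => a b def_x; exists 1; first by rewrite inE.
    by apply: associated_unit; move: xU; rewrite def_x unitrM => /andP[].
  have [L L_x] := finD x x0 (negbT xU).
  exists [:: 1, x & flatten [seq subproducts t | t <- L]] => a b def_x.
  case aU: (a \is a GRing.unit).
    by exists 1; [rewrite inE eqxx | apply: associated_unit].
  case bU: (b \is a GRing.unit).
    exists x; first by rewrite !inE eqxx orbT.
    by exists b^-1; rewrite ?unitrV // def_x [a * b]mulrC mulKr.
  have [a0 b0] : a != 0 /\ b != 0.
    by apply/andP; move: x0; rewrite def_x mulf_eq0 negb_or.
  have [sa [sa_irr def_a]] := atomD a a0 (negbT aU).
  have [sb [sb_irr def_b]] := atomD b b0 (negbT bU).
  have [|t tL /subproductsP[d dt dE]] := L_x (sa ++ sb).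
    split; last by rewrite big_cat /= -def_a -def_b.
    by move=> c; rewrite mem_cat => /orP[/sa_irr|/sb_irr].
  exists d; last by rewrite def_a.
  by rewrite 2!inE; apply/or3P/Or33/flatten_mapP; exists t.
split=> x x0 xU; have [s s_cov] := finD x x0.
  exact: covers_factorization s_cov.
exists (words (size s) s) => t xt; apply: associated_word.
  exact: covers_size_factorization s_cov xt.
move=> a a_t; apply: (s_cov a (\prod_(b <- rem a t) b)).
by rewrite xt.2 (perm_big _ (perm_to_rem a_t)) big_cons.
Qed.

(** A key that determines a divisor up to associates is enough: for each key
    that occurs, choose one divisor having it. The choice is by excluded middle
    along the list of keys, as a key need not be attained. *)
Lemma finitely_many_divisors_by_keys (T : eqType) (keys : seq T)
    (key : D -> T -> Prop) x :
  (forall a b, x = a * b -> exists2 k, k \in keys & key a k) ->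
  (forall a b a' b' k, x = a * b -> x = a' * b' -> key a k -> key a' k ->
     associated a a') ->
  finitely_many_divisors x.
Proof.
move=> has_key inj_key.
suff [s s_cov] : exists s, forall a b k, x = a * b -> k \in keys ->
    key a k -> exists2 d, d \in s & associated d a.
  by exists s => a b def_x; have [k] := has_key a b def_x; apply: s_cov def_x.
elim: keys {has_key} => [|k keys [s s_cov]]; first by exists [::].
have [[a [b [def_x ak]]]|no_k] := pselect (exists a b, x = a * b /\ key a k).
  exists (a :: s) => a' b' k' def_x' /[!inE] /orP[/eqP->|k's] a'k.
    by exists a; rewrite ?mem_head //; apply: (inj_key a b a' b' k).
  have [d ds da] := s_cov _ _ _ def_x' k's a'k.
  by exists d; rewrite // inE ds orbT.
exists s => a' b' k' def_x' /[!inE] /orP[/eqP->|k's] a'k.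
  by case: no_k; exists a', b'.
exact: s_cov def_x' k's a'k.
Qed.

End Associates.

(** * Retracts, polynomials over a field, and fractions *)

(** If [i a] is associated to [d] in [S], the retraction [e] maps the relation
    back to [R], since ring morphisms preserve units. *)
Lemma finitely_many_divisors_retract (R S : idomainType)
    (i : {rmorphism R -> S}) (e : {rmorphism S -> R}) x :
  cancel i e -> finitely_many_divisors (i x) -> finitely_many_divisors x.
Proof.
move=> iK [s s_cov]; exists [seq e d | d <- s] => a b def_x.
have [|d ds [u uU iaE]] := s_cov (i a) (i b); first by rewrite def_x rmorphM.
exists (e d); first exact: map_f.
by exists (e u); rewrite ?rmorph_unit // -[a]iK iaE rmorphM.
Qed.

(** Induction on the degree. Let [q] be a nonconstant divisor of [p = r * q] of
    least degree, so that [q] is irreducible: a divisor of [p] is either coprime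
    to [q], hence divides [r], or a multiple of [q], hence [q] times a divisor
    of [r]. *)
Lemma finitely_many_poly_divisors (F : fieldType) (p : {poly F}) : p != 0 ->
  exists s : seq {poly F}, forall d, d %| p -> exists2 e, e \in s & d %= e.
Proof.
have [n] := ubnP (size p); elim: n => // n IHn in p *; rewrite ltnS => le_p p0.
have [p1|p1] := eqVneq (size p) 1%N.
  exists [:: 1] => d d_p; exists 1; first by rewrite inE.
  have {}p1 : p %= 1 by rewrite -size_poly_eq1 p1.
  by rewrite -size_poly_eq1 -dvdp1 -(eqp_dvdr d p1).
pose Q m := `[< exists q : {poly F}, [/\ q %| p, size q != 1%N & size q = m] >].
have exQ : exists m, Q m by exists (size p); apply/asboolP; exists p.
(* [size q != 1] says that [q] is not constant, as [q] divides [p != 0]. *)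
have [m /asboolP[q [q_p q1 sz_q]] m_min] := ex_minnP exQ.
have /dvdpP[r def_p] := q_p.
have [r0 q0] : r != 0 /\ q != 0.
  by apply/andP; rewrite -negb_or -mulf_eq0 -def_p.
have q_gt1 : (1 < size q)%N by rewrite ltn_neqAle eq_sym q1 size_poly_gt0.
have [|//|s s_r] := IHn r.
  apply: leq_trans le_p; rewrite def_p size_mul //.
  by rewrite -subn1 -addnBA ?size_poly_gt0 // -[ltnLHS]addn0 ltn_add2l subn_gt0.
exists (s ++ [seq e * q | e <- s]) => d d_p.
have [cop|ncop] := boolP (coprimep d q).
  have [|e es de] := s_r d; first by rewrite -(Gauss_dvdpl r cop) -def_p.
  by exists e; rewrite ?mem_cat ?es.
have q_d : q %| d.
  have gq := dvdp_gcdr d q; apply: dvdp_trans (dvdp_gcdl d q).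
  have /eqp_dvdl -> // : q %= gcdp d q.
  rewrite eqp_sym -dvdp_size_eqp // eqn_leq dvdp_leq //= sz_q.
  by apply: m_min; apply/asboolP; exists (gcdp d q); rewrite (dvdp_trans gq).
have /dvdpP[d' def_d] := q_d.
have [|e es de] := s_r d'; first by rewrite -(dvdp_mul2r _ _ q0) -def_d -def_p.
exists (e * q); last by rewrite def_d eqp_mul2r.
by rewrite mem_cat; apply/orP; right; apply/mapP; exists e.
Qed.

Local Notation "x %:F" := (@FracField.tofrac _ x).

Lemma fracP (R : idomainType) (z : {fraction R}) :
  exists x y, y != 0 /\ z * y%:F = x%:F.
Proof.
elim/quotW: z => z; exists (frac z).1, (frac z).2; split; first exact: denom_ratioP.
unlock FracField.tofrac.
rewrite -[LHS]FracField.pi_mul; apply/eqmodP => /=.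
rewrite FracField.equivfE /FracField.mulf.
by rewrite !numden_Ratio ?mulr1 ?oner_neq0 ?denom_ratioP // mulrC.
Qed.

(** * Integer-valued polynomials *)

Section IntegerValued.
Variable R : idomainType.
Implicit Types (a r : R) (f g h : 'Int(R)).

Definition int_eval a f : R := projT1 (cid (int_valuedP _ (valP f) a)).

Lemma int_evalE a f : (int_eval a f)%:F = (val f).[a%:F].
Proof. by rewrite /int_eval; case: cid => b /= ->. Qed.

Lemma tofrac_inj : injective (@FracField.tofrac R).
Proof. by move=> x y /eqP; rewrite tofrac_eq => /eqP. Qed.

Fact int_eval_zmod a : zmod_morphism (int_eval a).
Proof.
by move=> f g; apply: tofrac_inj; rewrite rmorphB /= !int_evalE rmorphB hornerD hornerN.
Qed.

Fact int_eval_monoid a : monoid_morphism (int_eval a).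
Proof.
split=> [|f g]; apply: tofrac_inj; first by rewrite int_evalE !rmorph1 hornerC.
by rewrite [RHS]rmorphM /= !int_evalE rmorphM hornerM.
Qed.

HB.instance Definition _ a :=
  GRing.isZmodMorphism.Build 'Int(R) R (int_eval a) (int_eval_zmod a).
HB.instance Definition _ a :=
  GRing.isMonoidMorphism.Build 'Int(R) R (int_eval a) (int_eval_monoid a).

Fact int_const_subproof r : (r%:F)%:P \in @int_valued R.
Proof. by apply/int_valuedP => a; exists r; rewrite hornerC. Qed.

Definition int_const r : 'Int(R) := IntPoly (int_const_subproof r).

Fact int_const_zmod : zmod_morphism int_const.
Proof. by move=> r r'; apply: val_inj; rewrite [RHS]rmorphB /= !rmorphB. Qed.

Fact int_const_monoid : monoid_morphism int_const.
Proof.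
split=> [|r r']; apply: val_inj; first by rewrite [RHS]rmorph1 /= !rmorph1.
by rewrite [RHS]rmorphM /= !rmorphM.
Qed.

HB.instance Definition _ :=
  GRing.isZmodMorphism.Build R 'Int(R) int_const int_const_zmod.
HB.instance Definition _ :=
  GRing.isMonoidMorphism.Build R 'Int(R) int_const int_const_monoid.

Lemma int_constK a : cancel int_const (int_eval a).
Proof. by move=> r; apply: tofrac_inj; rewrite int_evalE hornerC. Qed.

(** The units of [R] are units of [Int(R)], whereas a scalar of [K] need not
    even lie in [Int(R)]; so divisors that are proportional over [K]
    are associates as soon as the ratio is a unit of [R]. *)
Lemma associated_int_const g h u :
  u \is a GRing.unit -> val h = u%:F *: val g -> associated g h.
Proof.
move=> uU hE; exists (int_const u); first exact: rmorph_unit.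
by apply: val_inj; rewrite rmorphM /= mul_polyC.
Qed.

(** If a nonzero [f] vanishes on [R], the powers of [r] are all among its
    finitely many roots, so two of them coincide, and cancelling in
    [r ^ i = r ^ j] leaves a positive power of [r] equal to 1. *)
Lemma vanishing_unit f : f != 0 -> (forall a, int_eval a f = 0) ->
  forall r, r != 0 -> r \is a GRing.unit.
Proof.
move=> f0 fv r r0; have vf0 : val f != 0 by rewrite -(inj_eq val_inj) rmorph0 in f0.
pose rs := [seq y%:F | y <- [seq r ^+ k | k <- iota 0 (size (val f))]].
have rs_root : all (root (val f)) rs.
  by apply/allP => _ /mapP[y _ ->]; rewrite /root -int_evalE fv rmorph0.
have /negP : ~ uniq rs.
  by move/(max_poly_roots vf0 rs_root); rewrite !size_map size_iota ltnn.
rewrite (map_inj_uniq tofrac_inj).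
case/(uniqPn 0) => i [j []]; rewrite size_map size_iota => lt_ij lt_j.
rewrite !(nth_map 0%N) ?size_iota ?nth_iota ?(ltn_trans lt_ij) // !add0n.
rewrite -(subnKC lt_ij) addSnnS exprD -[LHS]mulr1 => /(mulfI (expf_neq0 i r0)).
by rewrite exprS => /esym rE; apply/unitrPr; exists (r ^+ (j - i.+1)).
Qed.

(** The key of a divisor [g] of [f] is its class over [K] together with the
    class of its value at a point where [f] does not vanish; when there is no
    such point, the class over [K] alone, since all nonzero scalars are then
    units of [R]. *)
Lemma int_finitely_many_divisors f :
  (forall r, r != 0 -> finitely_many_divisors r) ->
  f != 0 -> finitely_many_divisors f.
Proof.
move=> finR f0; have vf0 : val f != 0 by rewrite -(inj_eq val_inj) rmorph0 in f0.
have [S S_f] := finitely_many_poly_divisors vf0.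
have val_dvd g h : f = g * h -> val g %| val f.
  by move=> ->; rewrite rmorphM dvdp_mulr.
have scaled g h e : val g %= e -> val h %= e ->
    exists2 c, c != 0 & val h = c *: val g.
  move=> ge he; have /eqpP[[c1 c2] /= /andP[c10 c20] E] : val g %= val h.
    by rewrite (eqp_trans ge) // eqp_sym.
  exists (c2^-1 * c1); first by rewrite mulf_neq0 ?invr_eq0.
  by rewrite -scalerA E scalerA mulVf ?scale1r.
have [[a fa0]|f_van] := pselect (exists a, int_eval a f != 0); last first.
  have unitR : forall r, r != 0 -> r \is a GRing.unit.
    apply: (vanishing_unit f0) => a; apply: contrapT => /eqP fa0.
    by apply: f_van; exists a.
  apply: (@finitely_many_divisors_by_keys _ _ S (fun g e => val g %= e)).
    by move=> g h /val_dvd/S_f[e es ge]; exists e.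
  move=> g _ h _ e _ _ ge he; have [c c0 hE] := scaled g h e ge he.
  have [x [y [y0 cE]]] := fracP c; have yU := unitR y y0.
  have cE' : c = (x / y)%:F.
    apply: (@mulIf _ y%:F); first by rewrite tofrac_eq0.
    by rewrite cE -rmorphM divrK.
  apply: (@associated_int_const _ _ (x / y)); last by rewrite -cE'.
  by apply: unitR; rewrite -tofrac_eq0 -cE'.
have [T T_fa] := finR _ fa0.
apply: (@finitely_many_divisors_by_keys _ _ (allpairs pair S T)
  (fun g k => val g %= k.1 /\ associated k.2 (int_eval a g))).
  move=> g h def_f; have [e eS ge] := S_f _ (val_dvd g h def_f).
  have [|d dT da] := T_fa (int_eval a g) (int_eval a h).
    by rewrite def_f rmorphM.
  by exists (e, d); [apply/allpairsP; exists (e, d) | split].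
move=> g g1 h _ [e d] def_f _ [/= ge gd] [he hd].
have [c _ hE] := scaled g h e ge he.
have [u uU haE] := associated_trans (associated_sym gd) hd.
apply: (associated_int_const uU); suff -> : u%:F = c by [].
(* The ratios [c] of [h] to [g] and [u] of [h(a)] to [g(a)] coincide because
   [g(a)], a divisor of [f(a)], is not 0. *)
apply: (@mulIf _ (int_eval a g)%:F).
  rewrite tofrac_eq0; apply: contraNneq fa0 => ga0.
  by rewrite def_f rmorphM /= ga0 mul0r.
by rewrite -rmorphM -haE /= !int_evalE -hornerZ -hE.
Qed.

End IntegerValued.

Theorem corollary4p7 (R : idomainType) : FFD 'Int(R) <-> FFD R.
Proof.
split=> /FFD_divisorsP finD; apply/FFD_divisorsP.
  move=> r r0; apply: (finitely_many_divisors_retract (int_constK 0)); apply: finD.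
  by rewrite -(rmorph0 (@int_const R)) (inj_eq (can_inj (int_constK 0))).
by move=> f; apply: int_finitely_many_divisors.
Qed.
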